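(* Let $A$ be an $n\times n$ integer matrix with nonzero determinant. Assume that $A$ is diagonalizable and that there is a unique eigenvalue $\lambda_1$ of maximal modulus, which is real and positive. Assume also that the eigenvalues of $A$ are arranged as $\lambda_1>|\lambda_2|\ge|\lambda_3|\ge\cdots\ge|\lambda_m|$ for some $m$. Then there is a constant $C\ge 1$ such that $$\deg(f_A^k)=C\cdot\lambda_1^k+O(|\lambda_2|^k)\qquad(k\to\infty).$$
   Context: For an integer matrix $A=(a_{i,j})$ of size $n\times n$, $f_A$ denotes the monomial map $f_A(x_1,\dots,x_n)=(\prod_j x_j^{a_{1,j}},\dots,\prod_j x_j^{a_{n,j}})$ and also the rational map $\mathbb{P}^n\dashrightarrow\mathbb{P}^n$ it induces via the embedding $(X_1,\dots,X_n)\mapsto[1;X_1;\dots;X_n]$. $f_A^k$ is the $k$-th iterate, equal to $f_{A^k}$. The degree $\deg(f)$ of a rational map $f:\mathbb{P}^n\dashrightarrow\mathbb{P}^n$ is the common degree of the homogeneous polynomials without common factor defining $f$ (equivalently, the integer by which $f^*$ acts on $\mathrm{Pic}(\mathbb{P}^n)\cong\mathbb{Z}$). Diagonalizable means over $\mathbb{C}$; $\lambda_1,\dots,\lambda_m$ are the distinct eigenvalues of $A$. If $m=1$ the error term is understood to be $0$. *)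

(* Defs.v *)
From HB Require Import structures.
From mathcomp Require Import all_boot all_order all_algebra.
From mathcomp Require Import boolp classical_sets.
From mathcomp Require Import mpoly.

Set Implicit Arguments.
Unset Strict Implicit.
Unset Printing Implicit Defensive.

Import GRing.Theory.
Local Open Scope ring_scope.

Section Monomial.
Context {F : closedFieldType} {n : nat}.

Definition torus (x : 'rV[F]_n) : Prop := forall i, x 0 i != 0.

Definition monomial_map (A : 'M[int]_n) (x : 'rV[F]_n) : 'rV[F]_n :=
  \row_i \prod_j x 0 j ^ A i j.

(* Homogeneous coordinates of [1; x_1; ...; x_n]. *)
Definition proj_embed (x : 'rV[F]_n) : 'I_n.+1 -> F :=
  (row_mx (1%:M : 'M_1) x : 'rV_(1 + n)) 0.

Definition no_common_factor (P : 'I_n.+1 -> {mpoly F[n.+1]}) : Prop :=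
  forall D, (forall i, exists Q, P i = Q * D) -> D \is a GRing.unit.

(* [P_0; ...; P_n] and the torus map g, extended along proj_embed, are the same
   rational map: their homogeneous coordinates are proportional on the torus.
   Where P vanishes identically the condition is void; for P nonzero, this is
   a proper closed subset of the (Zariski dense) torus. *)
Definition defined_by (g : 'rV[F]_n -> 'rV[F]_n)
    (P : 'I_n.+1 -> {mpoly F[n.+1]}) : Prop :=
  forall x, torus x -> forall i j,
    (P i).@[proj_embed x] * proj_embed (g x) j =
    (P j).@[proj_embed x] * proj_embed (g x) i.

Definition has_degree (g : 'rV[F]_n -> 'rV[F]_n) (d : nat) : Prop :=
  exists P : 'I_n.+1 -> {mpoly F[n.+1]},
    [/\ forall i, P i \is d.-homog, no_common_factor P & defined_by g P].

(* The degree of the rational map of P^n extending g; it is unique when it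
   exists, and 0 is a junk value for maps g that are not rational. *)
Definition rat_degree (g : 'rV[F]_n -> 'rV[F]_n) : nat :=
  xget 0%N [set d | has_degree g d]%classic.

End Monomial.

(* Main.v *)
Require Import Defs.
From mathcomp Require Import all_boot all_order all_algebra.
From mathcomp Require Import complex.
From mathcomp Require mpoly.
From mathcomp Require Import boolp classical_sets.
Import Order.TTheory GRing.Theory Num.Theory.
Local Open Scope classical_set_scope.
Local Open Scope ring_scope.

(** In homogeneous coordinates, the monomial map of a matrix [M] is given by
    Laurent monomials of degree 0, whose exponents form the matrix
    [homogenize M]. Multiplying all of them by the smallest monomial that clears
    the poles makes them coprime polynomials, so the degree of the rational map
    is the degree of that monomial:
      D(M) = sum over the variables j of max over the components i of - E i j,
    with E = [homogenize M] ([rat_degree_monomial_map]). As the iterates are the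
    monomial maps of the powers of [A], the theorem is about the growth of
    D(A ^+ k).

    The formula for D makes sense for real matrices, where D is Lipschitz
    ([monomial_degree_lipschitz]) and positively homogeneous
    ([monomial_degreeZ]). Diagonalizing [A] gives
      A ^+ k = lambda1 ^+ k *: Q + O(|lambda2| ^+ k),
    where [Q] is the spectral projection onto the eigenspace of [lambda1]
    ([spectral_expansion]). Applying D to both sides gives the asymptotics, with
    C = D(Q).

    The bound C >= 1 holds because D(M) bounds from above every real eigenvalue
    of [M] ([monomial_degree_ge_eigenvalue]), and [Q] fixes
    every eigenvector of [A] for [lambda1]. The reason is that the exponents
    after clearing the poles form a nonnegative matrix whose rows all sum to
    D(M), so that it stretches the gap between the largest and the smallest
    entry of a vector by a factor at most D(M). *)

(** * Degree of a matrix *)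

Section MonomialDegree.
Context {R : realDomainType} {n : nat}.
Implicit Types (M N : 'M[R]_n).

(** Row and column 0 belong to the coordinate X_0 of projective space; the other
    rows are obtained from those of [M] by substituting x_j = X_j / X_0. *)
Definition homogenize M : 'M[R]_(1 + n) :=
  block_mx 0 0 (- (M *m const_mx 1)) M.

(** The default value 0 of the maximum is also the entry of row 0, hence it is
    always one of the values compared. *)
Definition pole_order M j := \big[Num.max/0]_i - homogenize M i j.

Definition monomial_degree M := \sum_j pole_order M j.

Definition cleared_exponent M i j := pole_order M j + homogenize M i j.

Lemma homogenize0 M j : homogenize M (lshift n 0) j = 0.
Proof.
by case: (split_ordP j) => k ->; rewrite ?block_mxEul ?block_mxEur mxE.
Qed.

Lemma homogenize_left M i k :
  homogenize M (rshift 1 i) (lshift n k) = - \sum_j M i j.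
Proof.
by rewrite block_mxEdl !mxE; congr (- _); apply: eq_bigr => j _; rewrite mxE mulr1.
Qed.

Lemma homogenize_right M i j : homogenize M (rshift 1 i) (rshift 1 j) = M i j.
Proof. by rewrite block_mxEdr. Qed.

Lemma homogenize_row_sum M i : \sum_j homogenize M i j = 0.
Proof.
case: (split_ordP i) => k ->.
  by rewrite big1 // => j _; rewrite [k]ord1 homogenize0.
rewrite big_split_ord /= big_ord1 homogenize_left addrC.
by under eq_bigr do rewrite homogenize_right; rewrite subrr.
Qed.

Lemma cleared_exponent_ge0 M i j : 0 <= cleared_exponent M i j.
Proof. by rewrite -lerBlDr sub0r; exact: (le_bigmax _ (fun i => - homogenize M i j)). Qed.

Lemma cleared_exponent_eq0 M j : exists i, cleared_exponent M i j = 0.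
Proof.
suff [i eq_i] : exists i, pole_order M j = - homogenize M i j.
  by exists i; rewrite /cleared_exponent eq_i addNr.
apply: (big_ind (fun y => exists i, y = - homogenize M i j)) => [|x y|i _].
- by exists (lshift n 0); rewrite homogenize0 oppr0.
- by move=> [i ->] [k ->]; rewrite maxEle; case: ifP; [exists k | exists i].
- by exists i.
Qed.

Lemma cleared_exponent_row_sum M i : \sum_j cleared_exponent M i j = monomial_degree M.
Proof. by rewrite big_split /= homogenize_row_sum addr0. Qed.

(** Prepending a coordinate 0 to [v] gives an eigenvector [u] of [homogenize M],
    which is not constant. Between the rows of the largest and the smallest
    entry of [u], [homogenize M] and [cleared_exponent M] have the same
    difference; the rows of the latter are nonnegative with sum D(M), hence they
    average the entries of [u] up to the factor D(M). *)
Lemma monomial_degree_ge_eigenvalue M mu (v : 'cV[R]_n) :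
  v != 0 -> M *m v = mu *: v -> mu <= monomial_degree M.
Proof.
move=> v_neq0 Mv; pose u : 'cV[R]_(1 + n) := col_mx 0 v.
have Eu : homogenize M *m u = mu *: u.
  by rewrite mul_block_col !mul0mx addr0 mulmx0 add0r Mv scale_col_mx scaler0.
pose a := [arg max_(i > lshift n 0) u i 0]%O.
pose b := [arg min_(i < lshift n 0) u i 0]%O.
have le_a i : u i 0 <= u a 0 by rewrite /a; case: arg_maxP => // k _; apply.
have le_b i : u b 0 <= u i 0 by rewrite /b; case: arg_minP => // k _; apply.
have lt_ba : u b 0 < u a 0.
  rewrite lt_neqAle le_b andbT; apply: contra_neq v_neq0 => eq_ba.
  have u0 : u (lshift n 0) 0 = 0 by rewrite col_mxEu mxE.
  apply/colP => i; rewrite mxE; apply/eqP; rewrite eq_le.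
  have -> : v i 0 = u (rshift 1 i) 0 by rewrite col_mxEd.
  rewrite -u0 (le_trans (le_a _)) -?eq_ba //=.
  by rewrite (le_trans (le_a _)) -?eq_ba.
have EuE i : mu * u i 0 = \sum_j homogenize M i j * u j 0.
  by have /colP/(_ i) := Eu; rewrite !mxE.
rewrite -(ler_pM2r (x := u a 0 - u b 0)) ?subr_gt0 // mulrBr !EuE.
have -> : \sum_j homogenize M a j * u j 0 - \sum_j homogenize M b j * u j 0
   = \sum_j cleared_exponent M a j * u j 0 - \sum_j cleared_exponent M b j * u j 0.
  rewrite -!sumrB; apply: eq_bigr => j _.
  by rewrite -!mulrBl /cleared_exponent opprD addrACA subrr add0r.
have bound i y : y * monomial_degree M = \sum_j cleared_exponent M i j * y.
  by rewrite -(cleared_exponent_row_sum M i) mulrC mulr_suml.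
rewrite mulrC [X in _ <= X]mulrC mulrC mulrBl (bound a) (bound b).
by rewrite lerB //; apply: ler_sum => j _; rewrite ler_wpM2l ?cleared_exponent_ge0.
Qed.

Lemma bigmax_lipschitz (I : finType) (F G : I -> R) :
  `|\big[Num.max/0]_i F i - \big[Num.max/0]_i G i| <= \sum_i `|F i - G i|.
Proof.
elim/big_rec3: _ => [|i s y x _ IH]; first by rewrite subrr normr0.
have max_sub (a b c d : R) : Num.max a b - Num.max c d <= `|a - c| + `|b - d|.
  rewrite lerBlDr ge_max; apply/andP; split.
    rewrite -[leLHS](subrK c) lerD ?le_max ?lexx //.
    by rewrite (le_trans (ler_norm _)) // lerDl.
  rewrite -[leLHS](subrK d) lerD ?le_max ?lexx ?orbT //.
  by rewrite (le_trans (ler_norm _)) // lerDr.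
apply: (@le_trans _ _ (`|F i - G i| + `|x - y|)); last by rewrite lerD2l.
rewrite ler_norml lerNl opprB (distrC (F i)) (distrC x) max_sub.
by rewrite (distrC (G i)) (distrC y) max_sub.
Qed.

(** The factor 2 arises because an entry of [M] also contributes to column 0 of
    [homogenize M]. *)
Lemma monomial_degree_lipschitz M N :
  `|monomial_degree M - monomial_degree N|
    <= 2 * \sum_i \sum_j `|M i j - N i j|.
Proof.
rewrite /monomial_degree -sumrB (le_trans (ler_norm_sum _ _ _)) //.
apply: (@le_trans _ _ (\sum_j \sum_i `|homogenize M i j - homogenize N i j|)).
  apply: ler_sum => j _; rewrite (le_trans (bigmax_lipschitz _ _ _)) //.
  by apply: ler_sum => i _; rewrite -opprD normrN.
rewrite exchange_big big_split_ord /= big_ord1 [X in X + _]big1 ?add0r; last first.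
  by move=> j _; rewrite !homogenize0 subrr normr0.
rewrite mulr_sumr; apply: ler_sum => i _.
rewrite big_split_ord /= big_ord1 !homogenize_left -opprD normrN -sumrB.
under eq_bigr do rewrite !homogenize_right.
by rewrite mulr_natl mulr2n lerD2r ler_norm_sum.
Qed.
End MonomialDegree.

(** Covers both the embedding of the integers into the reals and multiplication
    by a nonnegative scalar. *)
Lemma monomial_degree_map {R S : realDomainType} {n} (f : R -> S) (M : 'M[R]_n) :
  {morph f : x y / x - y} -> {homo f : x y / x <= y} ->
  monomial_degree (map_mx f M) = f (monomial_degree M).
Proof.
move=> fB f_homo.
have f0 : f 0 = 0 by rewrite -(subrr 0) fB subrr.
have fN x : f (- x) = - f x by rewrite -(sub0r x) fB f0 sub0r.
have fD x y : f (x + y) = f x + f y by rewrite -[y]opprK fB !fN.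
have f_max : {morph f : x y / Num.max x y}.
  move=> x y; have [le_xy|/ltW le_yx] := leP x y; have := f_homo _ _.
    by move=> /(_ _ _ le_xy) /max_idPr.
  by move=> /(_ _ _ le_yx) /max_idPl.
have fE i j : homogenize (map_mx f M) i j = f (homogenize M i j).
  case: (split_ordP i) => k ->; first by rewrite [k]ord1 !homogenize0.
  case: (split_ordP j) => l ->; last by rewrite !homogenize_right mxE.
  rewrite [l]ord1 !homogenize_left fN (big_morph f fD f0).
  by congr (- _); apply: eq_bigr => m _; rewrite mxE.
rewrite /monomial_degree (big_morph f fD f0); apply: eq_bigr => j _.
rewrite /pole_order (big_morph f f_max f0).
by apply: eq_bigr => i _; rewrite fE fN.
Qed.

Lemma monomial_degreeZ {R : realDomainType} {n} (a : R) (M : 'M[R]_n) :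
  0 <= a -> monomial_degree (a *: M) = a * monomial_degree M.
Proof.
move=> a_ge0; rewrite -(monomial_degree_map ( *%R a)).
- by congr monomial_degree; apply/matrixP => i j; rewrite !mxE.
- by move=> x y; rewrite mulrBr.
- by move=> x y; exact: ler_wpM2l.
Qed.

(** * Rational degree of a monomial map *)

Module RationalDegree.
Import mpoly.

Section TorusDensity.
Context {F : closedFieldType}.

(** Otherwise [p * 'X + 1] would be a nonconstant polynomial without roots. *)
Lemma poly_torus_eq0 (p : {poly F}) : (forall t, t != 0 -> p.[t] = 0) -> p = 0.
Proof.
move=> p_torus; apply/eqP/negPn/negP => p_neq0.
have /closed_rootP[t] : size (p * 'X + 1) != 1%N.
  by rewrite size_MXaddC (negbTE p_neq0) /= eqSS size_poly_eq0.
rewrite rootE !hornerE; have [->|/p_torus ->] := eqVneq t 0.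
  by rewrite mulr0 add0r oner_eq0.
by rewrite mul0r add0r oner_eq0.
Qed.

(** Zariski density of the torus, by induction on the number of variables: at a
    given point of the smaller torus, the polynomial in the last variable
    vanishes on nonzero scalars, hence so does each of its coefficients. *)
Lemma meval_torus_eq0 n (p : {mpoly F[n]}) :
  (forall x, (forall i, x i != 0) -> p.@[x] = 0) -> p = 0.
Proof.
elim: n p => [|n IH] p p_torus.
  have := p_torus (fun=> 0); rewrite (nvar0_mpolyC p) mevalC => -> //.
  by case.
pose restr (m : 'X_{1..n.+1}) := [multinom m (widen_ord (leqnSn n) i) | i < n].
have muni_coef (m : 'X_{1..n.+1}) : ((muni p)`_(m ord_max))@_(restr m) = p@_m.
  rewrite muniE [in RHS](mpolyE p) coef_sum !raddf_sum /=.
  apply: eq_bigr => k _.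
  rewrite coefZ coefXn mcoeffZ mcoeffX mulr_natr mcoeffMn mcoeffZ mcoeffX.
  rewrite -mulrnAr -mulrnA mulnb; congr (_ * _%:R).
  congr (nat_of_bool _); apply/andP/eqP => [[/eqP eq_restr /eqP eq_max]|->].
    apply/mnmP => i; have [ltin|lein] := ltnP i n.
      have := congr1 (fun m : 'X_{1..n} => m (Ordinal ltin)) eq_restr.
      by rewrite !mnmE; congr (_ = _); congr (fun_of_multinom _ _); apply: val_inj.
    have -> : i = ord_max; last by [].
    by apply: val_inj => /=; apply/eqP; rewrite eqn_leq lein -ltnS ltn_ord.
  by split.
suff muni0 : muni p = 0 by apply/mpolyP => m; rewrite -muni_coef muni0 coef0 !mcoeff0.
apply/polyP => k; rewrite coef0; apply: IH => y y_neq0.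
pose q := map_poly (meval y) (muni p).
suff q0 : q = 0 by rewrite -(coef_map (meval y)) -/q q0 coef0.
apply: poly_torus_eq0 => t t_neq0.
pose x (i : 'I_n.+1) := oapp y t (insub (i : nat)).
rewrite -[RHS](p_torus x); last first.
  by move=> i; rewrite /x; case: insubP => [j _ _|_] /=; [exact: y_neq0 | exact: t_neq0].
rewrite mevalE /q muniE rmorph_sum horner_sum; apply: eq_bigr => m _ /=.
rewrite map_polyZ map_polyXn hornerZ hornerXn /= mevalZ mevalX -mulrA big_ord_recr /=.
congr (_ * (_ * _)); last by rewrite /x insubN // ltnn.
apply: eq_bigr => i _; rewrite mnmE; congr (_ ^+ _).
by rewrite /x insubT => [|ltin] /=; [exact: ltn_ord | congr (y _); apply: val_inj].
Qed.

End TorusDensity.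

Lemma meval_dhomog {R : comNzRingType} n d (p : {mpoly R[n]}) s (x : 'I_n -> R) :
  p \is d.-homog -> p.@[fun i => s * x i] = s ^+ d * p.@[x].
Proof.
move=> /dhomogP p_homog; rewrite !mevalE mulr_sumr !big_seq.
apply: eq_bigr => m /p_homog; rewrite /= mdegE => <-.
rewrite mulrCA -prodrXr -big_split; congr (_ * _).
by apply: eq_bigr => i _; rewrite exprMn.
Qed.

Section CommonFactor.
Context {F : fieldType} {m : nat} {I : Type} (w : I -> 'X_{1..m}) (i0 : I).
Hypothesis w_coprime : forall k, exists i, w i k = 0%N.

Lemma monomial_dvd (p : {mpoly F[m]}) (w0 : 'X_{1..m}) :
  (forall k, k \in msupp p -> (w0 <= k)%MM) -> exists q, p = q * 'X_[w0].
Proof.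
move=> w0_le; exists (\sum_(k <- msupp p) p@_k *: 'X_[k - w0]).
rewrite [LHS]mpolyE mulr_suml !big_seq; apply: eq_bigr => k /w0_le le_k.
by rewrite -scalerAl -mpolyXD submK.
Qed.

Lemma mpolyX_neq0 (k : 'X_{1..m}) : 'X_[k] != 0 :> {mpoly F[m]}.
Proof. by rewrite -msupp_eq0 msuppX. Qed.

(** Coprime monomials are, up to a common factor, the only polynomials in their
    proportion: for each variable choose [j] such that ['X_[w j]] is free of it;
    then [P i * 'X_[w j] = P j * 'X_[w i]] shows that each monomial of [P i]
    contains that variable at least as often as ['X_[w i]] does. *)
Lemma proportional_to_monomials (P : I -> {mpoly F[m]}) :
  (forall i j, P i * 'X_[w j] = P j * 'X_[w i]) ->
  exists Q, forall i, P i = Q * 'X_[w i].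
Proof.
move=> Pw.
have dvd i : exists q, P i = q * 'X_[w i].
  apply: monomial_dvd => k k_supp; apply/mnm_lepP => l.
  have [j wj0] := w_coprime l.
  have : (w j + k)%MM \in msupp (P j * 'X_[w i]).
    by rewrite -Pw mcoeff_msupp mcoeffMX -mcoeff_msupp.
  rewrite (perm_mem (msuppMX _ _)) => /mapP[k' _ eq_k].
  have := congr1 (fun a : 'X_{1..m} => a l) eq_k.
  by rewrite !mnmDE wj0 add0n => ->; rewrite leq_addr.
have [Q PQ] := dvd i0; exists Q => i; have [Q' PQ'] := dvd i.
have := Pw i i0; rewrite PQ PQ' -!mulrA -!mpolyXD addmC.
by move=> /(mulIf (mpolyX_neq0 _)) ->.
Qed.

(** After division by a common factor the monomials remain in the same
    proportion, hence by [proportional_to_monomials] they are multiples of the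
    original ones: the common factor is invertible. *)
Lemma monomials_no_common_factor (D : {mpoly F[m]}) :
  (forall i, exists Q, 'X_[w i] = Q * D) -> D \is a GRing.unit.
Proof.
move=> /choice[Q QD].
have D_neq0 : D != 0.
  by apply: contraTneq (mpolyX_neq0 (w i0)) => D0; rewrite QD D0 mulr0 eqxx.
have [i j|q Qq] := proportional_to_monomials Q.
  by apply: (mulIf D_neq0); rewrite mulrAC -QD mulrAC -QD mulrC.
have qD : q * D = 1.
  apply: (mulIf (mpolyX_neq0 (w i0))).
  by rewrite mul1r mulrAC -Qq -QD.
by apply/unitrP; exists q; rewrite (mulrC D) qD.
Qed.
End CommonFactor.

Section MonomialMaps.
Context {F : closedFieldType} {n : nat}.
Implicit Types (x : 'rV[F]_n) (A B : 'M[int]_n).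

Lemma monomial_mapM A B x : torus x ->
  monomial_map A (monomial_map B x) = monomial_map (A *m B) x.
Proof.
move=> x_neq0; apply/rowP => i; rewrite !mxE.
under eq_bigr => j _.
  rewrite mxE (big_morph (fun y : F => y ^ A i j) (id1 := 1) (op1 := *%R)); last first.
  - by rewrite exp1rz.
  - by move=> a b; rewrite expfzMl.
  under eq_bigr do rewrite exprz_exp mulrC.
  over.
rewrite exchange_big; apply: eq_bigr => k _; rewrite mxE.
rewrite (big_morph (fun e : int => x 0 k ^ e) (id1 := 1) (op1 := *%R)) //.
by move=> a b; rewrite expfzDr.
Qed.

Lemma iter_monomial_map A k x : torus x ->
  iter k (monomial_map A) x = monomial_map (A ^+ k) x.
Proof.
move=> x_neq0; elim: k => [|k IH]; last by rewrite iterS IH monomial_mapM // exprS.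
apply/rowP => i; rewrite expr0 mxE (bigD1 i) //= big1 ?mulr1 => [|j j_neq].
  by rewrite mxE eqxx.
by rewrite mxE eq_sym (negbTE j_neq).
Qed.

Definition cleared_monomial A i : 'X_{1..n.+1} :=
  [multinom `|cleared_exponent A i j|%N | j < n.+1].

Lemma mdeg_cleared_monomial A i :
  mdeg (cleared_monomial A i) = `|monomial_degree A|%N.
Proof.
rewrite mdegE -(cleared_exponent_row_sum A i).
apply/eqP; rewrite -eqz_nat gez0_abs; last first.
  by apply: sumr_ge0 => j _; exact: cleared_exponent_ge0.
rewrite (big_morph Posz PoszD erefl); apply/eqP/eq_bigr => j _.
by rewrite mnmE gez0_abs // cleared_exponent_ge0.
Qed.

Lemma cleared_monomial_coprime A k : exists i, cleared_monomial A i k = 0%N.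
Proof.
by have [i Wi0] := cleared_exponent_eq0 A k; exists i; rewrite mnmE Wi0.
Qed.

Lemma proj_embed0 x : proj_embed x (lshift n (0 : 'I_1)) = 1.
Proof. by rewrite /proj_embed row_mxEl mxE. Qed.

Lemma proj_embedS x k : proj_embed x (rshift 1 k) = x 0 k.
Proof. by rewrite /proj_embed row_mxEr. Qed.

Lemma proj_embed_monomial_map A x i : torus x ->
  proj_embed (monomial_map A x) i
    = \prod_(j < 1 + n) proj_embed x j ^ homogenize A i j.
Proof.
move=> x_neq0; rewrite big_split_ord /= big_ord1 proj_embed0 exp1rz mul1r.
case: (split_ordP (i : 'I_(1 + n))) => k ->.
  rewrite [k]ord1 proj_embed0 big1 // => j _.
  by rewrite homogenize0 expr0z.
rewrite proj_embedS mxE; apply: eq_bigr => j _.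
by rewrite proj_embedS homogenize_right.
Qed.

Lemma meval_cleared_monomial A x : torus x -> exists2 c, c != 0 &
  forall i, 'X_[cleared_monomial A i].@[proj_embed x] =
            c * proj_embed (monomial_map A x) i.
Proof.
move=> x_neq0; have px_neq0 j : proj_embed x j != 0.
  by case: (split_ordP (j : 'I_(1 + n))) => k ->;
    rewrite ?[k]ord1 ?proj_embed0 ?proj_embedS ?oner_neq0.
exists (\prod_j proj_embed x j ^ pole_order A j).
  by apply/prodf_neq0 => j _; exact: expfz_neq0.
move=> i; rewrite mevalX proj_embed_monomial_map // -big_split.
apply: eq_bigr => j _ /=; rewrite mnmE -expfzDr //.
by rewrite exprnP gez0_abs // cleared_exponent_ge0.
Qed.

(** By homogeneity, an identity on the points [1; x_1; ...; x_n] with [x] in the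
    torus of dimension n extends to the torus of dimension n + 1, where it can
    be checked by density. *)
Lemma defined_by_monomial_map A (g : 'rV[F]_n -> 'rV[F]_n) d P :
    (forall x, torus x -> g x = monomial_map A x) ->
    (forall i, P i \is d.-homog) -> defined_by g P ->
  forall i j,
    P i * 'X_[cleared_monomial A j] = P j * 'X_[cleared_monomial A i].
Proof.
move=> gA P_homog gP i j; apply/eqP; rewrite -subr_eq0; apply/eqP.
apply: meval_torus_eq0 => z z_neq0.
pose x : 'rV[F]_n := \row_k (z (rshift 1 k) / z (lshift n (0 : 'I_1))).
have x_torus : torus x by move=> k; rewrite mxE mulf_neq0 ?invr_eq0.
have zE : z =1 (fun k => z (lshift n (0 : 'I_1)) * proj_embed x k).
  move=> k; case: (split_ordP (k : 'I_(1 + n))) => l ->; first by rewrite [l]ord1 proj_embed0 mulr1.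
  by rewrite proj_embedS mxE mulrC divfK.
have W_homog k : ('X_[cleared_monomial A k] : {mpoly F[n.+1]}) \is (`|monomial_degree A|%N).-homog.
  by rewrite dhomogX; apply/eqP/mdeg_cleared_monomial.
have scaleP k := meval_dhomog _ _ _ (z (lshift n (0 : 'I_1))) (proj_embed x) (P_homog k).
have scaleW k := meval_dhomog _ _ _ (z (lshift n (0 : 'I_1))) (proj_embed x) (W_homog k).
have [c _ cE] := meval_cleared_monomial A x x_torus.
rewrite mevalB !mevalM !(meval_eq _ zE) !scaleP !scaleW !cE.
have := gP x x_torus i j; rewrite gA // => P_ij.
apply/eqP; rewrite subr_eq0 mulrACA [X in _ == X]mulrACA; apply/eqP.
by congr (_ * _); rewrite mulrCA P_ij mulrCA.
Qed.

(** The cleared monomials define the map. Conversely, any coprime [P] defining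
    it is [Q] times these monomials by [proportional_to_monomials]; as [Q] is a
    common factor, it is a constant, so [P] has the same degree. *)
Lemma rat_degree_monomial_map A (g : 'rV[F]_n -> 'rV[F]_n) :
    (forall x, torus x -> g x = monomial_map A x) ->
  rat_degree g = `|monomial_degree A|%N.
Proof.
move=> gA; apply: xget_unique.
  exists (fun i => 'X_[cleared_monomial A i]); split.
  - by move=> i; rewrite dhomogX; apply/eqP/mdeg_cleared_monomial.
  - move=> D; apply: (monomials_no_common_factor _ ord0).
    exact: cleared_monomial_coprime.
  - move=> x x_torus i j; rewrite gA //.
    have [c _ cE] := meval_cleared_monomial A x x_torus.
    by rewrite !cE mulrAC.
move=> d [P [P_homog P_coprime gP]].
have [Q PQ] := proportional_to_monomials _ ord0 (cleared_monomial_coprime A) P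
  (defined_by_monomial_map A g d P gA P_homog gP).
have /unitrP[Q' [Q'Q _]] : Q \is a GRing.unit.
  by apply: P_coprime => i; exists 'X_[cleared_monomial A i]; rewrite PQ mulrC.
have Q_neq0 : Q != 0.
  by apply: contra_eq_neq Q'Q => ->; rewrite mulr0 eq_sym oner_neq0.
have P_neq0 : P ord0 != 0 by rewrite PQ mulf_neq0 // mpolyX_neq0.
apply: (dhomog_uniq P_neq0 (P_homog ord0)).
have /andP[/eqP Q_const _] : mpoly_unit Q by apply: mpoly_intro_unit Q'Q.
rewrite PQ Q_const mul_mpolyC dhomogZ // dhomogX.
by apply/eqP/mdeg_cleared_monomial.
Qed.
End MonomialMaps.

Lemma rat_degree_iter_monomial_map {R : rcfType} {n} (A : 'M[int]_n) k :
  (rat_degree (iter k (@monomial_map R[i] n A)))%:R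
    = monomial_degree (map_mx intr (A ^+ k)) :> R.
Proof.
rewrite (rat_degree_monomial_map (A ^+ k)); last first.
  by move=> x; exact: iter_monomial_map.
rewrite monomial_degree_map; last 2 first.
- by move=> a b; rewrite intrB.
- by move=> a b; rewrite ler_int.
rewrite -[RHS](congr1 intr (gez0_abs _)) //.
rewrite -(cleared_exponent_row_sum _ (lshift n 0)) sumr_ge0 // => j _.
exact: cleared_exponent_ge0.
Qed.
End RationalDegree.

From mathcomp Require Import reals topology normedtype sequences landau.
Import numFieldNormedType.Exports.
Local Open Scope complex_scope.

(** * Powers of a diagonalizable real matrix *)

Section SpectralAsymptotics.
Context {R : rcfType} {n : nat} (B : 'M[R]_n) (mu : R).
Let Bc : 'M[R[i]]_n := map_mx (real_complex R) B.

Lemma ReD : {morph @complex.Re R : x y / x + y}.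
Proof. by move=> [a b] [c d]. Qed.

Lemma complex_norm_ge0 (z : R[i]) : 0 <= Normc.normc z.
Proof. by case: z => a b; exact: sqrtr_ge0. Qed.

Lemma Re_sum (I : Type) (r : seq I) (P : pred I) (F : I -> R[i]) :
  complex.Re (\sum_(i <- r | P i) F i) = \sum_(i <- r | P i) complex.Re (F i).
Proof. by apply: big_morph => // -[a b] [c d]. Qed.

Lemma Re_realM (a : R) (z : R[i]) : complex.Re (a%:C * z) = a * complex.Re z.
Proof. by case: z => x y /=; rewrite mul0r subr0. Qed.

Lemma normc_sum (I : Type) (r : seq I) (P : pred I) (F : I -> R[i]) :
  Normc.normc (\sum_(i <- r | P i) F i) <= \sum_(i <- r | P i) Normc.normc (F i).
Proof.
elim/big_rec2: _ => [|i x y _ IH]; first by rewrite Normc.normc0.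
by rewrite (le_trans (le_normcD _ _)) // lerD2l.
Qed.

Lemma normr_Re_le (z : R[i]) : `|complex.Re z| <= Normc.normc z.
Proof. by rewrite -lecR; exact: normc_ge_Re. Qed.

Lemma normcX (z : R[i]) k : Normc.normc (z ^+ k) = Normc.normc z ^+ k.
Proof. by elim: k => [|k IH]; rewrite ?Normc.normc1 // !exprS Normc.normcM IH. Qed.

(** The real part of [z] or that of ['i *: z] is a nonzero real eigenvector. *)
Lemma real_eigenvector (z : 'cV[R[i]]_n) :
  z != 0 -> Bc *m z = mu%:C *: z ->
  exists2 v : 'cV[R]_n, v != 0 & B *m v = mu *: v.
Proof.
have Re_eigen (y : 'cV[R[i]]_n) : Bc *m y = mu%:C *: y ->
    B *m map_mx (@complex.Re R) y = mu *: map_mx (@complex.Re R) y.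
  move=> By; apply/colP => i; have /colP/(_ i) := By; rewrite !mxE.
  move=> /(congr1 (@complex.Re R)); rewrite Re_realM Re_sum => <-.
  by apply: eq_bigr => j _; rewrite !mxE Re_realM.
move=> z_neq0 Bz.
have [Re_z0|] := eqVneq (map_mx (@complex.Re R) z) 0; last first.
  by move=> Re_z; exists (map_mx (@complex.Re R) z) => //; exact: Re_eigen.
exists (map_mx (@complex.Re R) ('i *: z)); last first.
  by apply: Re_eigen; rewrite -scalemxAr Bz !scalerA mulrC.
apply: contra_neq z_neq0 => Im_z0; apply/colP => i.
have /colP/(_ i) := Im_z0; have /colP/(_ i) := Re_z0; rewrite !mxE.
by case: (z i 0) => a b /= ->; rewrite mul0r mul1r sub0r => /eqP; rewrite oppr_eq0 => /eqP ->.
Qed.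

(** [Q] is the real part of the spectral projection for [mu], and [d] lists the
    diagonal entries of a diagonal form of [B]. Taking real parts makes [Q] a
    real matrix without any argument on the reality of the projection: it costs
    nothing in the estimate since the powers of [B] are real, and [Q] still
    fixes every real eigenvector for [mu]. *)
Lemma spectral_expansion :
  diagonalizable Bc -> eigenvalue Bc mu%:C ->
  exists (Q : 'M[R]_n) (v : 'cV[R]_n) (d : 'I_n -> R[i]) (c : 'I_n -> R),
  [/\ v != 0, Q *m v = v, forall l, eigenvalue Bc (d l),
      forall l, 0 <= c l &
      forall k i j, `|(B ^+ k) i j - mu ^+ k * Q i j|
        <= \sum_(l | d l != mu%:C) c l * Normc.normc (d l) ^+ k].
Proof.
move=> [W W_unit /(diagonalizable_forLR W_unit)[d]].
rewrite mxpoly.conjVmx //; set V := invmx W => BcE.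
have VW : V *m W = 1%:M by rewrite mulVmx.
have WV : W *m V = 1%:M by rewrite mulmxV.
have WB : W *m Bc = diag_mx d *m W by rewrite BcE !mulmxA WV mul1mx.
have BV : Bc *m V = V *m diag_mx d by rewrite BcE -!mulmxA WV mulmx1.
have BcX k i j : (Bc ^+ k) i j = \sum_l V i l * d 0 l ^+ k * W l j.
  have WBX : W *m Bc ^+ k = diag_mx (\row_l d 0 l ^+ k) *m W.
    elim: k => [|k IH].
      rewrite expr0 mulmx1; apply/matrixP => a b; rewrite mul_diag_mx !mxE.
      by rewrite expr0 mul1r.
    rewrite exprSr mulmxA IH -mulmxA WB mulmxA; congr (_ *m _).
    by rewrite mulmx_diag; congr diag_mx; apply/rowP => l; rewrite !mxE exprSr.
  rewrite -[Bc ^+ k]mul1mx -VW -mulmxA WBX mulmxA !mxE.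
  by apply: eq_bigr => l _; rewrite mul_mx_diag !mxE.
have d_eigen l : eigenvalue Bc (d 0 l).
  apply/eigenvalueP; exists (row l W).
    by rewrite -row_mul WB mul_diag_mx; apply/rowP => j; rewrite !mxE.
  apply: contra_neq (oner_neq0 R[i]) => Wl0.
  have : row l (W *m V) = 0 by rewrite row_mul Wl0 mul0mx.
  by rewrite WV => /rowP/(_ l); rewrite !mxE eqxx.
move=> /eigenvalueP[u uB u_neq0].
have [l0 dl0] : exists l, d 0 l = mu%:C.
  have uV_neq0 : u *m V != 0.
    by apply: contra_neq u_neq0 => uV0; rewrite -[u]mulmx1 -VW mulmxA uV0 mul0mx.
  have /rV0Pn[l uVl] := uV_neq0; exists l; apply: (mulfI uVl).
  have /rowP/(_ l) : u *m V *m diag_mx d = mu%:C *: (u *m V).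
    by rewrite -mulmxA -BV mulmxA uB scalemxAl.
  by rewrite mul_mx_diag !mxE [RHS]mulrC.
have [v v_neq0 Bv] : exists2 v : 'cV[R]_n, v != 0 & B *m v = mu *: v.
  apply: (real_eigenvector (col l0 V)).
    apply: contra_neq (oner_neq0 R[i]) => Vl0.
    have := congr1 (fun M : 'M_n => M l0 l0) WV; rewrite !mxE eqxx mulr1n => <-.
    by rewrite big1 // => k _; have /colP/(_ k) := Vl0; rewrite !mxE => ->; rewrite mulr0.
  rewrite !colE mulmxA BV -mulmxA scalemxAr; congr (_ *m _); apply/matrixP => a b.
  rewrite mul_diag_mx !mxE; have [->|_] := eqVneq a l0; by rewrite ?dl0 ?mulr0.
pose Qc i j := \sum_(l | d 0 l == mu%:C) V i l * W l j.
exists (\matrix_(i, j) complex.Re (Qc i j)), v, (fun l => d 0 l).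
exists (fun l => \sum_i \sum_j Normc.normc (V i l) * Normc.normc (W l j)).
split=> //.
- pose vc := map_mx (real_complex R) v.
  have Bvc : Bc *m vc = mu%:C *: vc by rewrite -map_mxM Bv map_mxZ.
  have Wvc l : d 0 l != mu%:C -> (W *m vc) l 0 = 0.
    apply: contra_neq_eq => Wv_neq0; apply: (mulIf Wv_neq0).
    have : diag_mx d *m (W *m vc) = mu%:C *: (W *m vc).
      by rewrite mulmxA -WB -mulmxA Bvc scalemxAr.
    by rewrite mul_diag_mx => /colP/(_ l); rewrite !mxE.
  (* Only the rows of W for the eigenvalue mu see vc, so restricting the
     expansion V *m W = 1 to these rows does not change its value at vc. *)
  have Qvc i : \sum_j Qc i j * vc j 0 = vc i 0.
    have -> : vc i 0 = (V *m (W *m vc)) i 0 by rewrite mulmxA VW mul1mx.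
    rewrite [RHS]mxE [in RHS](bigID (fun l => d 0 l == mu%:C)) /=.
    rewrite [X in _ = _ + X]big1 ?addr0; last first.
      by move=> l /Wvc ->; rewrite mulr0.
    under eq_bigr do rewrite mulr_suml.
    rewrite exchange_big; apply: eq_bigr => l _.
    by rewrite [in RHS]mxE mulr_sumr; apply: eq_bigr => j _; rewrite mulrA.
  apply/colP => i; have /(congr1 (@complex.Re R)) := Qvc i.
  rewrite Re_sum [vc i 0]mxE /= => <-; rewrite mxE; apply: eq_bigr => j _.
  by rewrite !mxE [in RHS]mulrC Re_realM mulrC.
- by move=> l; do 2!apply: sumr_ge0 => ? _; rewrite mulr_ge0 ?complex_norm_ge0.
move=> k i j.
have -> : (B ^+ k) i j = complex.Re ((Bc ^+ k) i j) by rewrite -rmorphXn mxE.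
rewrite BcX (bigID (fun l => d 0 l == mu%:C)) /= mxE -Re_realM.
rewrite [X in complex.Re (X + _)](_ : _ = (mu ^+ k)%:C * Qc i j); last first.
  rewrite mulr_sumr; apply: eq_bigr => l /eqP ->.
  by rewrite rmorphXn mulrCA mulrA.
rewrite ReD addrAC subrr add0r (le_trans (normr_Re_le _)) // (le_trans (normc_sum _ _ _ _)) //.
apply: ler_sum => l _; rewrite !Normc.normcM normcX mulrAC.
rewrite ler_wpM2r ?exprn_ge0 ?complex_norm_ge0 //.
rewrite (bigD1 i) //= ler_wpDr //.
  by do 2!apply: sumr_ge0 => ? _; rewrite mulr_ge0 ?complex_norm_ge0.
rewrite (bigD1 j) //= lerDl.
by apply: sumr_ge0 => ? _; rewrite mulr_ge0 ?complex_norm_ge0.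
Qed.
End SpectralAsymptotics.

(** * Growth of the degrees of the iterates *)

(** The error is kept as a sum over the other eigenvalues, so that it vanishes
    for all [k] when [mu] is the only one. *)
Lemma monomial_degree_exp_asymptotics {R : rcfType} {n} (B : 'M[R]_n) (mu : R) :
    0 < mu -> diagonalizable (map_mx (real_complex R) B) ->
    eigenvalue (map_mx (real_complex R) B) mu%:C ->
  exists (C : R) (d : 'I_n -> R[i]) (c : 'I_n -> R),
  [/\ 1 <= C, forall l, eigenvalue (map_mx (real_complex R) B) (d l),
      forall l, 0 <= c l &
      forall k, `|monomial_degree (B ^+ k) - C * mu ^+ k|
        <= \sum_(l | d l != mu%:C) c l * Normc.normc (d l) ^+ k].
Proof.
move=> mu_gt0 B_diag mu_eigen.
have [Q [v [d [c [v_neq0 Qv d_eigen c_ge0 bound]]]]] :=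
  spectral_expansion B mu B_diag mu_eigen.
exists (monomial_degree Q), d, (fun l => 2 * \sum_(i < n) \sum_(j < n) c l).
split=> //.
- by apply: (monomial_degree_ge_eigenvalue _ _ v) => //; rewrite scale1r.
- by move=> l; rewrite mulr_ge0 // !sumr_ge0 // => i _; rewrite sumr_ge0.
move=> k; rewrite [_ Q * _]mulrC -monomial_degreeZ ?exprn_ge0 ?(ltW mu_gt0) //.
rewrite (le_trans (monomial_degree_lipschitz _ _)) //.
under [leRHS]eq_bigr do rewrite -mulrA mulr_suml.
rewrite -mulr_sumr ler_wpM2l // [leRHS]exchange_big; apply: ler_sum => i _ /=.
under [leRHS]eq_bigr do rewrite mulr_suml.
by rewrite [leRHS]exchange_big; apply: ler_sum => j _ /=; rewrite [in leLHS]mxE.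
Qed.

Theorem theorem6p6 (R : realType) (n : nat) (A : 'M[int]_n)
    (lambda1 : R) (lambdas : seq R[i])
    (A_det : \det A != 0)
    (A_diag : diagonalizable (map_mx intr A : 'M[R[i]]_n))
    (eigenvalues : forall z : R[i],
       (z \in lambda1%:C :: lambdas) = eigenvalue (map_mx intr A) z)
    (distinct : uniq (lambda1%:C :: lambdas))
    (lambda1_gt0 : 0 < lambda1)
    (lambda1_max : forall z, z \in lambdas -> Normc.normc z < lambda1)
    (arranged : sorted (fun z w => Normc.normc w <= Normc.normc z) lambdas) :
  let deg k := rat_degree (iter k (@monomial_map R[i] n A)) in
  exists C : R, 1 <= C /\
    match lambdas with
    | [::] => forall k : nat, (deg k)%:R = C * lambda1 ^+ k
    | lambda2 :: _ =>
        (fun k : nat => (deg k)%:R - C * lambda1 ^+ k : R^o)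
          =O_\oo (fun k : nat => Normc.normc lambda2 ^+ k : R^o)
    end.
Proof.
move=> deg.
have AE : map_mx intr A = map_mx (real_complex R) (map_mx intr A) :> 'M[R[i]]_n.
  by apply/matrixP => i j; rewrite !mxE rmorph_int.
have [||C [d [c [C_ge1 d_eigen c_ge0 bound]]]] :=
    monomial_degree_exp_asymptotics (map_mx intr A) lambda1 lambda1_gt0.
- by rewrite -AE.
- by rewrite -AE -eigenvalues mem_head.
have d_lambdas l : d l != lambda1%:C -> d l \in lambdas.
  by have := d_eigen l; rewrite -AE -eigenvalues inE => /predU1P[->|//]; rewrite eqxx.
have degE k : (deg k)%:R = monomial_degree ((map_mx intr A : 'M[R]_n) ^+ k).
  by rewrite RationalDegree.rat_degree_iter_monomial_map rmorphXn.
exists C; split=> //.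
case: lambdas => [|lambda2 lambdas] in eigenvalues distinct lambda1_max arranged d_lambdas *.
  move=> k; apply/eqP; rewrite -subr_eq0 -normr_le0 degE (le_trans (bound k)) //.
  by rewrite big_pred0 // => l; apply/negbTE/negP => d_neq; have := d_lambdas l d_neq.
have le_lambda2 l : d l != lambda1%:C -> Normc.normc (d l) <= Normc.normc lambda2.
  move=> /d_lambdas; rewrite inE => /predU1P[->//|].
  apply/allP: (d l); apply: order_path_min arranged => x y z le_xy le_zx.
  exact: le_trans le_zx le_xy.
(* The summand 1 makes the constant positive even if all c l vanish. *)
apply/eqO_exP; exists (1 + \sum_l c l).
  by rewrite ltr_wpDr ?sumr_ge0.
apply: nearW => k; rewrite degE (le_trans (bound k)) //.
rewrite ger0_norm ?exprn_ge0 ?complex_norm_ge0 //.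
rewrite mulrDl mul1r ler_wpDl ?exprn_ge0 ?complex_norm_ge0 //.
rewrite mulr_suml [leRHS](bigID (fun l => d l != lambda1%:C)) /=.
rewrite ler_wpDr ?sumr_ge0 // => [l _|]; first by rewrite mulr_ge0 ?exprn_ge0 ?complex_norm_ge0.
apply: ler_sum => l /le_lambda2 le_l; apply: ler_wpM2l => //.
by apply: lerXn2r; rewrite ?nnegrE ?complex_norm_ge0.
Qed.
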